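(* Let $N\in\mathbb N^+$, $c>0$, $0<\gamma<1$, and let $T=\{t_k:k\in\mathbb N\}$ with $t_0=0$ and $t_k=Nk+ck^\gamma$ for $k\ge1$. Put $Q_{T,N}(r)=\sum_{k\ge0}|r^{t_k}-r^{Nk}|^2$ for $0<r<1$ and $q^*(T,N)=\limsup_{r\uparrow1}Q_{T,N}(r)$. Then, as $u\downarrow0$, $$Q_{T,N}(e^{-u})\sim\frac{c^2\,\Gamma(2\gamma+1)}{(2N)^{2\gamma+1}}\,u^{1-2\gamma}.$$ Consequently, $$q^*(T,N)=\begin{cases}0,&0<\gamma<\tfrac12,\\[1mm] \dfrac{c^2}{4N^2},&\gamma=\tfrac12,\\[2mm] +\infty,&\tfrac12<\gamma<1.\end{cases}$$
   Context: $\mathbb N=\{0,1,2,\dots\}$, $\mathbb N^+=\{1,2,\dots\}$. $\Gamma$ is the Euler Gamma function. $f(u)\sim g(u)$ as $u\downarrow0$ means $f(u)/g(u)\to1$. *)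

(* Defs.v *)
From HB Require Import structures.
From mathcomp Require Import all_boot all_order all_algebra.
From mathcomp Require Import all_classical all_reals all_analysis.
Import Order.TTheory GRing.Theory Num.Theory numFieldNormedType.Exports.

Set Implicit Arguments.
Unset Strict Implicit.
Unset Printing Implicit Defensive.

Local Open Scope classical_set_scope.
Local Open Scope ring_scope.

(* Gamma is absent from the library.  For 0 < s the integral converges, so the
   real-valued integral carries no junk value. *)
Definition Gamma {R : realType} (s : R) : R :=
  \int[lebesgue_measure]_(x in `]0, +oo[) (x `^ (s - 1) * expR (- x)).

(* The set T is represented by its enumeration t, since Q_{T,N} depends on it
   only through the sequence (t_k). *)
Definition tseq {R : realType} (N : nat) (c gamma : R) : R^nat :=
  fun k => if k == 0%N then 0 else (N * k)%:R + c * k%:R `^ gamma.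

(* Valued in \bar R: no summability of the nonnegative terms is presupposed. *)
Definition Q {R : realType} (t : R^nat) (N : nat) (r : R) : \bar R :=
  (\sum_(0 <= k <oo) (`|r `^ t k - r ^+ (N * k)| ^+ 2)%:E)%E.

Definition qstar {R : realType} (t : R^nat) (N : nat) : \bar R :=
  limf_esup (Q t N) 1^'-.

(* f(u) ~ g(u) as u decreases to 0.  A limit equal to 1 in \bar R forces f to
   be eventually finite. *)
Definition equiv_at_right0 {R : realType} (f : R -> \bar R) (g : R -> R) : Prop :=
  (f u / (g u)%:E)%E @[u --> 0^'+] --> 1%:E.

(* Main.v *)
Require Import Defs.
From HB Require Import structures.
From mathcomp Require Import all_boot all_order all_algebra.
From mathcomp Require Import all_classical all_reals all_analysis.
From mathcomp Require Import measurable_realfun ring lra.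
Import Order.TTheory GRing.Theory Num.Theory numFieldNormedType.Exports.
Local Open Scope classical_set_scope.
Local Open Scope ring_scope.

(* With r = e^{-u}, h = 2Nu and x_k = c u k^gamma, the k-th term of Q is
   e^{-hk} (1 - e^{-x_k})^2, which lies between e^{-hk} (x_k^2 - 2 x_k^3) and
   e^{-hk} x_k^2.  So Q reduces to the sums h sum_k f(hk) with
   f(x) = x^a e^{-x}, a = 2 gamma or 3 gamma.  On an interval of length h on the
   right of x the increasing factor x^a only grows and e^{-x} loses at most a
   factor e^{-h}; comparing with the integral of f on the mesh ]hk, h(k+1)],
   once with each endpoint, puts the sum between e^{-h} Gamma(a+1) and
   e^h Gamma(a+1).  The cubic correction is smaller than the main term by a
   factor O(u^{1-gamma}). *)

(** * The Gamma integral and its step sums *)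

Definition gamma_integrand {R : realType} (a x : R) : R := x `^ a * expR (- x).

(** Valued in [\bar R], so that it can be split and compared before it is known to be finite. Its
    value is Gamma(a+1), not Gamma(a). *)
Definition gamma_integral {R : realType} (a : R) : \bar R :=
  (\int[lebesgue_measure]_(x in `]0%R, +oo[) (gamma_integrand a x)%:E)%E.

Section gamma_integral.
Context {R : realType}.
Implicit Types a h x y : R.
Local Notation mu := (@lebesgue_measure R).

Lemma gamma_integrand_ge0 a x : 0 <= gamma_integrand a x.
Proof. by rewrite mulr_ge0 ?powR_ge0 ?expR_ge0. Qed.

Lemma gamma_integrand0 a : 0 < a -> gamma_integrand a 0 = 0.
Proof. by move=> a0; rewrite /gamma_integrand powR0 ?mul0r// gt_eqF. Qed.

Lemma measurable_gamma_integrand a (D : set R) :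
  measurable_fun D (gamma_integrand a).
Proof.
apply: (@measurable_funS _ _ _ _ setT) => //.
apply: measurable_funM; first exact: measurable_powR.
exact: (measurableT_comp (f := expR)).
Qed.

Lemma emeasurable_gamma_integrand a (D : set R) :
  measurable_fun D (fun x => (gamma_integrand a x)%:E).
Proof. apply/measurable_EFinP; exact: measurable_gamma_integrand. Qed.

Lemma gamma_integrand_le a h x y : 0 <= a -> 0 <= x -> x <= y -> y <= x + h ->
  gamma_integrand a x <= expR h * gamma_integrand a y.
Proof.
move=> a0 x0 xy yxh; rewrite /gamma_integrand mulrCA -expRD.
apply: ler_pM; rewrite ?powR_ge0 ?expR_ge0// ?ler_expR; last by lra.
by apply: ge0_ler_powR => //; rewrite nnegrE// (le_trans x0).
Qed.

(** Open on the left and closed on the right, so that the cells tile exactly the open half-line,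
    without 0. *)
Definition mesh h k : set R := `](h * k%:R), (h * k.+1%:R)]%classic.

Lemma measurable_mesh h k : measurable (mesh h k).
Proof. exact: measurable_itv. Qed.

Lemma mesh_bigcup h : 0 < h ->
  `]0, +oo[%classic = \bigcup_k mesh h k.
Proof.
move=> h0; apply/seteqP; split => x /=.
  rewrite in_itv/= andbT => x0.
  have xh : 0 < x / h by rewrite divr_gt0.
  have : 0 < Num.ceil (x / h) by rewrite ceil_gt0.
  have := ceil_itv (x / h).
  (* The ceiling is positive, hence a successor; the cell containing x has index ceil(x/h) - 1. *)
  case: (Num.ceil (x / h)) => [[//|k]|//] /andP[kx xk] _; exists k => //=.
  rewrite /mesh/= in_itv/= ![h * _]mulrC -ltr_pdivlMr// -ler_pdivrMr// xk andbT.
  by apply: le_lt_trans kx; rewrite -addn1 PoszD addrK.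
move=> [k _]; rewrite /mesh /= !in_itv/= andbT => /andP[+ _].
by apply: le_lt_trans; rewrite mulr_ge0// ltW.
Qed.

Lemma mesh_trivIset h : 0 < h ->
  trivIset setT (mesh h).
Proof.
move=> h0; apply: ltn_trivIset => n m mn; rewrite -subset0 => x.
rewrite /mesh => -[] /=; rewrite !in_itv/= => /andP[_ xm] /andP[nx _].
have : h * m.+1%:R <= h * n%:R by rewrite ler_pM2l// ler_nat.
by rewrite leNgt => /negP; apply; exact: lt_le_trans nx xm.
Qed.

Lemma gamma_integral_mesh a h : 0 < h ->
  (gamma_integral a = \sum_(0 <= k <oo)
    \int[mu]_(x in mesh h k) (gamma_integrand a x)%:E)%E.
Proof.
move=> h0; rewrite /gamma_integral (mesh_bigcup h h0).
rewrite ge0_integral_bigcup//.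
- by move=> k; exact: measurable_mesh.
- exact: emeasurable_gamma_integrand.
- by move=> x _; rewrite lee_fin gamma_integrand_ge0.
- exact: mesh_trivIset.
Qed.

Lemma integral_cst_mesh h k (c : R) : 0 < h ->
  (\int[mu]_(x in mesh h k) c%:E = (h * c)%:E)%E.
Proof.
move=> h0; rewrite integral_cst//; last exact: measurable_mesh.
rewrite /= lebesgue_measure_itv/= lte_fin ltr_pM2l// ltr_nat ltnSn.
by rewrite -EFinB -EFinM; congr EFin; rewrite -natr1; ring.
Qed.

(** Left endpoints: f(hk) is at most e^h f(x) on the whole cell [mesh h k], whose length is h. *)
Lemma riemann_sum_le a h : 0 <= a -> 0 < h ->
  (\sum_(0 <= k <oo) (h * gamma_integrand a (h * k%:R)%R)%:E
   <= (expR h)%:E * gamma_integral a)%E.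
Proof.
move=> a0 h0; rewrite (gamma_integral_mesh a h h0) -nneseriesZl; last first.
  by move=> k _; apply: integral_ge0 => x _;
    rewrite lee_fin gamma_integrand_ge0.
apply: lee_nneseries => k.
  by move=> _ _; rewrite lee_fin mulr_ge0 ?gamma_integrand_ge0// ltW.
move=> _; rewrite -(integral_cst_mesh _ k)//.
rewrite -ge0_integralZl_EFin ?expR_ge0//; last 3 first.
- exact: measurable_mesh.
- by move=> x _; rewrite lee_fin gamma_integrand_ge0.
- exact: emeasurable_gamma_integrand.
- apply: ge0_le_integral => //; first exact: measurable_mesh.
  + by move=> x _; rewrite lee_fin gamma_integrand_ge0.
  + apply/measurable_EFinP; apply: measurable_funM => //.
    exact: measurable_gamma_integrand.
  move=> x; rewrite /mesh/= in_itv/= -EFinM lee_fin => /andP[kx xk].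
  apply: gamma_integrand_le => //; [|exact: ltW|].
    by rewrite mulr_ge0// ltW.
  by rewrite (le_trans xk)// -natr1; lra.
Qed.

Lemma gamma_integral_le a h : 0 < a -> 0 < h ->
  (gamma_integral a <=
   (expR h)%:E * \sum_(0 <= k <oo) (h * gamma_integrand a (h * k%:R)%R)%:E)%E.
Proof.
move=> a0 h0; have s0 k : (0 <= (h * gamma_integrand a (h * k%:R)%R)%:E)%E.
  by rewrite lee_fin mulr_ge0 ?gamma_integrand_ge0// ltW.
(* The term k = 0 vanishes because 0 < a. Dropping it shifts the index by one, so that cell k meets
   h(k+1), its right endpoint. *)
rewrite (@nneseries_recl _ xpredT)//=.
rewrite mulr0 gamma_integrand0// mulr0 add0e.
rewrite -(@nneseries_addn _
  (fun k => (h * gamma_integrand a (h * k%:R)%R)%:E) 1)//.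
rewrite (gamma_integral_mesh a h h0) -nneseriesZl//.
apply: lee_nneseries => k.
  by move=> _ _; apply: integral_ge0 => x _;
    rewrite lee_fin gamma_integrand_ge0.
move=> _; rewrite addn1 -EFinM mulrCA -(integral_cst_mesh _ k)//.
apply: ge0_le_integral => //; first exact: measurable_mesh.
- by move=> x _; rewrite lee_fin gamma_integrand_ge0.
- exact: emeasurable_gamma_integrand.
move=> x; rewrite /mesh/= in_itv/= lee_fin => /andP[kx xk].
apply: gamma_integrand_le => //; first exact: ltW.
  by rewrite (le_trans _ (ltW kx))// mulr_ge0// ltW.
move: kx; rewrite -natr1; lra.
Qed.

(** * Finiteness, positivity and a special value of Gamma *)

Lemma gamma_integral_lty a : 0 < a -> (gamma_integral a < +oo)%E.
Proof.
(* The integrand is dominated by (2a)^a e^{-x/2}. The factor 2 in [C] cancels the factor 1/2 of the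
   exponential density of rate 1/2, whose mass is 1. *)
move=> a0; pose C := (2 * a) `^ a * 2.
have aa : 0 < 2 * a by lra.
have C0 : 0 <= C by rewrite mulr_ge0 ?powR_ge0.
have half0 : 0 < 2^-1 :> R by rewrite invr_gt0.
apply: (@le_lt_trans _ _ (\int[mu]_(x in `]0%R, +oo[)
   (C%:E * (exponential_pdf 2^-1 x)%:E))%E).
  apply: ge0_le_integral => //.
  - by move=> x _; rewrite lee_fin gamma_integrand_ge0.
  - exact: emeasurable_gamma_integrand.
  - apply/measurable_EFinP; apply: measurable_funM => //.
    apply: measurable_funTS; exact: measurable_exponential_pdf.
  move=> x /=; rewrite in_itv/= andbT => x0.
  rewrite -EFinM lee_fin exponential_pdfE ?(ltW x0)// /gamma_integrand.
  have -> : C * (2^-1 * expR (- 2^-1 * x)) =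
    (2 * a) `^ a * expR (x / 2) * expR (- x).
    have -> : - 2^-1 * x = x / 2 + - x by field.
    by rewrite /C expRD; field.
  rewrite ler_pM2r ?expR_gt0//.
  (* t <= e^t at t = x / (2a) gives x^a <= (2a)^a e^{x/2}. *)
  have xa0 : 0 <= x / (2 * a) by rewrite divr_ge0// ltW.
  have -> : x / 2 = x / (2 * a) * a by field; rewrite gt_eqF.
  have {1}-> : x = 2 * a * (x / (2 * a)) by field; rewrite gt_eqF.
  rewrite powRM ?(ltW aa)// ler_wpM2l ?powR_ge0// expRM.
  apply: ge0_ler_powR; rewrite ?nnegrE ?expR_ge0//; first exact: ltW.
  by apply: le_trans (expR_ge1Dx _); rewrite lerDr.
rewrite ge0_integralZl_EFin//; last 2 first.
- by move=> x _; rewrite lee_fin exponential_pdf_ge0// ltW.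
- apply/measurable_EFinP/measurable_funTS; exact: measurable_exponential_pdf.
apply: lte_mul_pinfty => //.
apply: (@le_lt_trans _ _ (\int[mu]_x (exponential_pdf 2^-1 x)%:E)%E).
  apply: ge0_subset_integral => //.
    apply/measurable_EFinP; exact: measurable_exponential_pdf.
  by move=> x _; rewrite lee_fin exponential_pdf_ge0// ltW.
by rewrite integral_exponential_pdf// ltry.
Qed.

Lemma gamma_integral_Gamma a : 0 < a -> gamma_integral a = (Gamma (a + 1))%:E.
Proof.
move=> a0; rewrite /Gamma /Rintegral addrK fineK// ge0_fin_numE.
  exact: gamma_integral_lty.
by apply: integral_ge0 => x _; rewrite lee_fin gamma_integrand_ge0.
Qed.

Lemma riemann_sum_gamma a h : 0 < a -> 0 < h ->
  exists2 s : R,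
    (\sum_(0 <= k <oo) (h * gamma_integrand a (h * k%:R)%R)%:E = s%:E)%E &
    expR (- h) * Gamma (a + 1) <= s <= expR h * Gamma (a + 1).
Proof.
move=> a0 h0; have := riemann_sum_le a h (ltW a0) h0.
have := gamma_integral_le a h a0 h0.
rewrite gamma_integral_Gamma//.
have : (0 <= \sum_(0 <= k <oo) (h * gamma_integrand a (h * k%:R)%R)%:E)%E.
  apply: nneseries_ge0 => k _ _.
  by rewrite lee_fin mulr_ge0 ?gamma_integrand_ge0// ltW.
(* The upper bound, now a real number, excludes +oo; nonnegativity excludes -oo. *)
case: (\sum_(0 <= k <oo) _)%E => [s| |]//= _.
rewrite -EFinM !lee_fin => lo hi; exists s => //.
by rewrite hi andbT expRN mulrC ler_pdivrMr ?expR_gt0// mulrC.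
Qed.

(** For h = 1, e Gamma(a+1) bounds the step sum, which is at least its term e^{-1} at k = 1. *)
Lemma Gamma_gt0 a : 0 < a -> 0 < Gamma (a + 1) :> R.
Proof.
move=> a0; have [s sE /andP[_ sG]] := riemann_sum_gamma a 1 a0 ltr01.
have s0 k : (0 <= (1 * gamma_integrand a (1 * k%:R)%R)%:E)%E.
  by rewrite lee_fin mul1r gamma_integrand_ge0.
rewrite -(pmulr_rgt0 _ (expR_gt0 1)); apply: lt_le_trans sG.
rewrite -lte_fin -sE (@nneseriesD1 _ _ 1%N)//.
apply: (@lt_le_trans _ _ (1 * gamma_integrand a (1 * 1%:R)%R)%:E).
  by rewrite lte_fin !mul1r /gamma_integrand mulr_gt0 ?powR_gt0 ?expR_gt0.
by rewrite leeDl//; apply: nneseries_ge0 => k _ _; exact: s0.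
Qed.

(** This is the value of Gamma(2 gamma + 1) at gamma = 1/2; it comes from the antiderivative
    -(x+1)e^{-x} of x e^{-x}. *)
Lemma Gamma2 : Gamma 2 = 1 :> R.
Proof.
have -> : 2 = 1 + 1 :> R by [].
apply: EFin_inj; rewrite -gamma_integral_Gamma//.
pose F (x : R) := - ((x + 1) * expR (- x)).
have dF (x : R) : is_derive x 1 F (x * expR (- x)).
  by apply: is_derive_eq; rewrite /GRing.scale/=; ring.
rewrite /gamma_integral integral_itv_obnd_cbnd; last first.
  exact: emeasurable_gamma_integrand.
transitivity (\int[mu]_(x in `[0%R, +oo[) (x * expR (- x))%:E)%E.
  apply: eq_integral => x; rewrite inE/= in_itv/= andbT => x0.
  by rewrite /gamma_integrand powRr1.
rewrite (@ge0_continuous_FTC2y _ _ F 0 0).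
- by rewrite sub0e /F add0r mul1r oppr0 expR0 -EFinN opprK.
- by move=> x x0; rewrite mulr_ge0 ?expR_ge0.
- apply: continuous_subspaceT => x; apply: differentiable_continuous.
  exact/derivable1_diffP/ex_derive.
- have e0 : - (2 * expR (- (2^-1 * x))) @[x --> +oo] --> (0 : R).
    rewrite -oppr0; apply: cvgN; rewrite -[X in _ --> X](mulr0 2).
    apply: cvgMl_tmp.
    apply: (@cvg_comp _ _ _ _ (fun z => expR (- z)) _ (pinfty_nbhs R)).
      exact: gt0_cvgMry.
    exact: cvgr_expR.
  apply: squeeze_cvgr e0 (cvg_cst 0).
  near=> x; have x0 : 0 < x by near: x; exact: nbhs_pinfty_gt.
  rewrite /F lerN2 oppr_le0 mulr_ge0 ?expR_ge0 ?andbT//; last by lra.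
  have -> : - x = - (2^-1 * x) + - (2^-1 * x) by field.
  rewrite expRD mulrA ler_wpM2r ?expR_ge0// expRN ler_pdivrMr ?expR_gt0//.
  by have := expR_ge1Dx (2^-1 * x); lra.
- by move=> x _; exact: ex_derive.
- apply: cvg_at_right_filter; apply: differentiable_continuous.
  exact/derivable1_diffP/ex_derive.
- by move=> x _; rewrite derive1E; exact: derive_val.
Unshelve. all: by end_near. Qed.

End gamma_integral.

(** * Upper limits of convergent functions *)

Lemma limf_esup_cvg {R : realType} (F : set_system R)
    {FF : ProperFilter F} (f : R -> \bar R) (l : \bar R) :
  f x @[x --> F] --> l -> limf_esup f F = l.
Proof.
(* The upper limit is the infimum of sup f(V) over V in [F]. Each such supremum bounds f eventually,
   hence bounds its limit. *)
move=> fl; apply/eqP; rewrite eq_le; apply/andP; split; last first.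
  apply/le_ereal_inf_tmp => _ [V FV <-]; apply: (cvge_to_le fl).
  by apply: filterS FV => x Vx; apply: ereal_sup_ubound; exists x.
(* For y above l, the set where f < y belongs to [F] and serves as V. *)
have le_near y : (l < y)%E -> (limf_esup f F <= y)%E.
  move=> ly; apply: (@le_trans _ _ (ereal_sup (f @` [set x | (f x < y)%E]))).
    apply: ereal_inf_lbound; exists [set x | (f x < y)%E] => //.
    apply: (fl [set z | (z < y)%E]).
    exact: (open_nbhs_nbhs (conj (@open_ereal_lt_ereal _ y) ly)).
  by apply: ge_ereal_sup => _ [x xy <-]; exact: ltW.
case: l fl le_near => [l| |] fl le_near; last 2 first.
- exact: leey.
- case: (limf_esup f F) le_near => [r| |]//.
  + by move=> /(_ (r - 1)%:E (ltNyr _)); rewrite lee_fin lerBrDr gerDl ler10.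
  + by move=> /(_ 0%E (ltNyr _)).
apply/lee_addgt0Pr => e e0; apply: le_near.
by rewrite -EFinD lte_fin ltrDl.
Qed.

(** * Termwise bounds and rescaling *)

Section kernel_bounds.
Context {R : realType}.
Implicit Types x : R.

Lemma sqr_1BexpN_le x : 0 <= x -> (1 - expR (- x)) ^+ 2 <= x ^+ 2.
Proof.
move=> x0; rewrite ler_sqr ?nnegrE//; last first.
  by rewrite subr_ge0 expR_le1 oppr_le0.
by have := expR_ge1Dx (- x); lra.
Qed.

(** The cubic error is added on the right rather than subtracted, so that summation over k meets
    only nonnegative series. *)
Lemma sqr_1BexpN_ge x : 0 <= x ->
  x ^+ 2 <= (1 - expR (- x)) ^+ 2 + 2 * x ^+ 3.
Proof.
move=> x0; set w := 1 - expR (- x).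
(* e^x >= 1 + x gives 1 - e^{-x} >= x e^{-x}, and e^{-x} >= 1 - x. *)
have wx : x * (1 - x) <= w.
  have e1 := expR_ge1Dx (- x); have := expR_ge1Dx x.
  have : expR x * expR (- x) = 1 by rewrite expRxMexpNx_1.
  have := expR_gt0 (- x); rewrite /w.
  nra.
(* For x > 1 the claim is trivial, as x^2 <= 2 x^3; for x <= 1 the bound x(1-x) <= w has nonnegative
   sides and can be squared. *)
have [x1|x1] := leP x 1; last first.
  by have := sqr_ge0 w; nra.
have : (x * (1 - x)) ^+ 2 <= w ^+ 2.
  have p0 : 0 <= x * (1 - x) by rewrite mulr_ge0// subr_ge0.
  by rewrite ler_sqr// nnegrE// (le_trans p0).
have : 0 <= x ^+ 4 by rewrite exprn_ge0.
have -> : (x * (1 - x)) ^+ 2 = x ^+ 2 - 2 * x ^+ 3 + x ^+ 4 by ring.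
lra.
Qed.

(** Writing k^gamma as (hk)^gamma / h^gamma turns the terms into those of a step sum; the extra
    power of h is the mesh width. *)
Lemma powR_expR_gamma_integrand (gamma h : R) (m k : nat) : 0 < gamma -> 0 < h ->
  (k%:R `^ gamma) ^+ m * expR (- (h * k%:R)) =
  (h * gamma_integrand (m%:R * gamma) (h * k%:R)) / h `^ (m%:R * gamma + 1).
Proof.
move=> g0 h0; rewrite /gamma_integrand powRM ?(ltW h0)//.
rewrite powRD ?(gt_eqF h0) ?implybT// powRr1 ?(ltW h0)//.
have -> : k%:R `^ (m%:R * gamma) = (k%:R `^ gamma) ^+ m.
  by rewrite mulrC powRrM powR_mulrn ?powR_ge0.
by field; rewrite !gt_eqF ?powR_gt0.
Qed.

(** The separate value at k = 0 fits the general formula because 0^gamma = 0 for gamma > 0. *)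
Lemma tseqE (N : nat) (c gamma : R) k : 0 < gamma ->
  tseq N c gamma k = (N * k)%:R + c * k%:R `^ gamma.
Proof.
move=> g0; rewrite /tseq; case: eqVneq => [->|//].
by rewrite muln0 powR0 ?mulr0 ?addr0// gt_eqF.
Qed.

Lemma Q_term (N : nat) (c gamma u : R) k : 0 < gamma ->
  `|expR (- u) `^ tseq N c gamma k - expR (- u) ^+ (N * k)| ^+ 2 =
  expR (- (2 * N%:R * u * k%:R)) *
    (1 - expR (- (c * u * k%:R `^ gamma))) ^+ 2.
Proof.
move=> g0; rewrite real_normK ?num_real// tseqE// -expRM -expRM_natl.
have -> : - u * ((N * k)%:R + c * k%:R `^ gamma) =
  (N * k)%:R * - u + - (c * u * k%:R `^ gamma) by ring.
have -> : - (2 * N%:R * u * k%:R) = (N * k)%:R * - u + (N * k)%:R * - u.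
  by rewrite natrM; ring.
by rewrite !expRD; ring.
Qed.

End kernel_bounds.

(** * Two-sided bounds for Q at fixed u *)

Section Q_asymptotics.
Context {R : realType} (N : nat) (c gamma : R).
Context (N_gt0 : (0 < N)%N) (c_gt0 : 0 < c) (gamma_gt0 : 0 < gamma).
Implicit Types u : R.

(** The factors [a] and [b] turn the step sums with exponents 2 gamma and 3 gamma into the sums of
    e^{-hk} x_k^2 and 2 e^{-hk} x_k^3. *)
Lemma Q_bounds u (h := 2 * N%:R * u)
    (a := (c * u) ^+ 2 / h `^ (2 * gamma + 1))
    (b := 2 * (c * u) ^+ 3 / h `^ (3 * gamma + 1)) : 0 < u ->
  exists2 q : R, Q (tseq N c gamma) N (expR (- u)) = q%:E &
    a * (expR (- h) * Gamma (2 * gamma + 1)) -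
      b * (expR h * Gamma (3 * gamma + 1)) <= q <=
    a * (expR h * Gamma (2 * gamma + 1)).
Proof.
move=> u0; have h0 : 0 < h by rewrite !mulr_gt0 ?ltr0n.
have a0 : 0 <= a by rewrite divr_ge0 ?powR_ge0 ?exprn_ge0 ?mulr_ge0 ?ltW.
have b0 : 0 <= b.
  by rewrite divr_ge0 ?powR_ge0// mulr_ge0// exprn_ge0// mulr_ge0// ltW.
have g2 : 0 < 2 * gamma by rewrite mulr_gt0.
have g3 : 0 < 3 * gamma by rewrite mulr_gt0.
have [s2 s2E /andP[lo2 hi2]] := riemann_sum_gamma (2 * gamma) h g2 h0.
have [s3 s3E /andP[lo3 hi3]] := riemann_sum_gamma (3 * gamma) h g3 h0.
have x0 k : 0 <= c * u * k%:R `^ gamma.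
  by rewrite !mulr_ge0 ?powR_ge0 ?(ltW c_gt0) ?(ltW u0).
have aE k : a * (h * gamma_integrand (2 * gamma) (h * k%:R)) =
    expR (- (h * k%:R)) * (c * u * k%:R `^ gamma) ^+ 2.
  rewrite exprMn [RHS]mulrC -[RHS]mulrA (powR_expR_gamma_integrand gamma h 2) //.
  by rewrite /a; ring.
have bE k : b * (h * gamma_integrand (3 * gamma) (h * k%:R)) =
    expR (- (h * k%:R)) * (2 * (c * u * k%:R `^ gamma) ^+ 3).
  rewrite exprMn [RHS]mulrC -[RHS]mulrA -[X in _ = 2 * X]mulrA
    (powR_expR_gamma_integrand gamma h 3)//.
  by rewrite /b; ring.
have hg0 m k : (0 <= (h * gamma_integrand m (h * k%:R)%R)%:E)%E.
  by rewrite lee_fin mulr_ge0 ?gamma_integrand_ge0// ltW.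
have Q0 : (0 <= Q (tseq N c gamma) N (expR (- u)))%E.
  by apply: nneseries_ge0 => k _ _; rewrite lee_fin sqr_ge0.
have Qle : (Q (tseq N c gamma) N (expR (- u)) <= (a * s2)%:E)%E.
  rewrite EFinM -s2E -nneseriesZl//; apply: lee_nneseries => k.
    by move=> _ _; rewrite lee_fin sqr_ge0.
  move=> _; rewrite -EFinM aE lee_fin Q_term//.
  by rewrite ler_wpM2l ?expR_ge0// sqr_1BexpN_le.
have Qge : ((a * s2)%:E <= Q (tseq N c gamma) N (expR (- u)) + (b * s3)%:E)%E.
  rewrite !EFinM -s2E -s3E -!nneseriesZl//.
  rewrite -nneseriesD; last 2 first.
  - by move=> k _ _; rewrite lee_fin sqr_ge0.
  - by move=> k _ _; rewrite mule_ge0.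
  apply: lee_nneseries => k; first by move=> _ _; rewrite mule_ge0.
  move=> _; rewrite -!EFinM -EFinD aE bE lee_fin Q_term//.
  by rewrite -mulrDr ler_wpM2l ?expR_ge0// sqr_1BexpN_ge.
move: Q0 Qle Qge; case: (Q _ _ _) => [q| |]// _.
rewrite -EFinD !lee_fin => qle qge; exists q => //.
apply/andP; split; last by rewrite (le_trans qle)// ler_wpM2l.
rewrite lerBlDr (le_trans (ler_wpM2l a0 lo2))// (le_trans qge)//.
by rewrite lerD2l ler_wpM2l.
Qed.

(** The claimed equivalent, equal to a Gamma(2 gamma + 1) with the [a] of [Q_bounds]. *)
Definition Qequiv u : R := c ^+ 2 * Gamma (2 * gamma + 1) /
  (2 * N%:R) `^ (2 * gamma + 1) * u `^ (1 - 2 * gamma).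

Lemma Qequiv_gt0 u : 0 < u -> 0 < Qequiv u.
Proof.
move=> u0; have D0 : 0 < 2 * N%:R :> R by rewrite mulr_gt0 ?ltr0n.
apply: mulr_gt0; last exact: powR_gt0.
apply: divr_gt0; last exact: powR_gt0.
by apply: mulr_gt0; rewrite ?exprn_gt0// Gamma_gt0// mulr_gt0.
Qed.

Lemma Q_ratio_bounds : exists K : R, forall u, 0 < u ->
  exists2 q : R, Q (tseq N c gamma) N (expR (- u)) = (q * Qequiv u)%:E &
    expR (- (2 * N%:R * u)) - K * u `^ (1 - gamma) * expR (2 * N%:R * u)
      <= q <= expR (2 * N%:R * u).
Proof.
set D := 2 * N%:R : R; have D0 : 0 < D by rewrite mulr_gt0 ?ltr0n.
set G2 := Gamma (2 * gamma + 1) : R; set G3 := Gamma (3 * gamma + 1) : R.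
have G20 : 0 < G2 by rewrite Gamma_gt0// mulr_gt0.
(* The ratio of the cubic term to the main term, b Gamma(3 gamma + 1) / (a Gamma(2 gamma + 1)), with
   its factor u^{1-gamma} removed. *)
exists (2 * c * D `^ (2 * gamma + 1) / D `^ (3 * gamma + 1) * G3 / G2) => u u0.
have [q qE /andP[lo hi]] := Q_bounds u u0.
have g0 := Qequiv_gt0 u u0.
exists (q / Qequiv u); first by rewrite qE divfK// gt_eqF.
have uN0 : u != 0 by rewrite gt_eqF.
have aE : (c * u) ^+ 2 / (D * u) `^ (2 * gamma + 1) * G2 = Qequiv u.
  rewrite /Qequiv -/D -/G2 powRM ?ltW//.
  have -> : 1 - 2 * gamma = 2%:R - (2 * gamma + 1) by ring.
  rewrite powRB ?uN0 ?implybT// powR_mulrn ?ltW//.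
  by field; rewrite !gt_eqF ?powR_gt0.
have bE : 2 * (c * u) ^+ 3 / (D * u) `^ (3 * gamma + 1) * G3 =
  2 * c * D `^ (2 * gamma + 1) / D `^ (3 * gamma + 1) * G3 / G2 *
    u `^ (1 - gamma) * Qequiv u.
  rewrite -aE !(powRM _ (ltW D0) (ltW u0)).
  have -> : u `^ (1 - gamma) =
      u `^ 1 * u `^ (2 * gamma + 1) / u `^ (3 * gamma + 1).
    rewrite -powRD ?uN0 ?implybT// -powRB ?uN0 ?implybT//.
    by congr (u `^ _); ring.
  rewrite powRr1 ?ltW//.
  by field; rewrite !gt_eqF ?powR_gt0.
rewrite ler_pdivrMr// ler_pdivlMr// mulrBl [X in _ - X <= _]mulrAC -bE -aE.
apply/andP; split; [apply: le_trans lo|apply: le_trans hi _];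
  by rewrite -/D -/G2 -/G3 le_eqVlt; apply/predU1P; left; ring.
Qed.

End Q_asymptotics.

(** * Passage to the limit in u and in r *)

Lemma cvg_Q_ratio {R : realType} (N : nat) (c gamma : R)
    (N_gt0 : (0 < N)%N) (c_gt0 : 0 < c)
    (gamma_gt0 : 0 < gamma) (gamma_lt1 : gamma < 1) :
  exists2 q : R -> R, q u @[u --> 0^'+] --> (1 : R) & forall u, 0 < u ->
    Q (tseq N c gamma) N (expR (- u)) = (q u * Qequiv N c gamma u)%:E.
Proof.
have [K HK] := Q_ratio_bounds N c gamma N_gt0 c_gt0 gamma_gt0.
(* For u > 0, Q is finite and [Qequiv] is positive, so neither [fine] nor the division yields a
   default value. *)
pose q u := fine (Q (tseq N c gamma) N (expR (- u))) / Qequiv N c gamma u.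
have qP u : 0 < u -> Q (tseq N c gamma) N (expR (- u)) =
    (q u * Qequiv N c gamma u)%:E /\
  expR (- (2 * N%:R * u)) - K * u `^ (1 - gamma) * expR (2 * N%:R * u)
      <= q u <= expR (2 * N%:R * u).
  move=> u0; have [r rE rb] := HK u u0.
  have g0 : 0 < Qequiv N c gamma u by exact: Qequiv_gt0.
  by rewrite /q rE/= mulfK ?gt_eqF.
exists q; last by move=> u /qP[].
have cexp (a : R) : expR (a * u) @[u --> 0^'+] --> (1 : R).
  have au : a * u @[u --> (0 : R)^'+] --> (0 : R).
    rewrite -[X in _ --> X](mulr0 a); apply: cvgMl_tmp.
    by apply: cvg_at_right_filter; exact: cvg_id.
  by rewrite -expR0; exact: (cvg_comp _ _ au (@continuous_expR R 0)).
(* Both bounds tend to 1: since gamma < 1, u^{1-gamma} tends to 0. *)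
apply: (@squeeze_cvgr _ _ _ _
  (fun u => expR (- (2 * N%:R) * u) -
            K * u `^ (1 - gamma) * expR (2 * N%:R * u))
  (fun u => expR (2 * N%:R * u))).
- near=> u; rewrite mulNr.
  by have [] := qP u _.
- rewrite -[X in _ --> X]subr0; apply: cvgB; first exact: cexp.
  rewrite -[X in _ --> X](mul0r 1); apply: cvgM; last exact: cexp.
  rewrite -[X in _ --> X](mulr0 K); apply: cvgMl_tmp.
  by apply: powR_cvg0; rewrite subr_gt0.
- exact: cexp.
Unshelve. all: by end_near. Qed.

(** The substitution u = -ln r carries r increasing to 1 into u decreasing to 0. *)
Lemma qstar_cvg {R : realType} (t : R^nat) (N : nat) (l : \bar R) :
  Q t N (expR (- u)) @[u --> 0^'+] --> l -> qstar t N = l.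
Proof.
move=> Ql; apply: limf_esup_cvg.
have lnl : - ln r @[r --> (1 : R)^'-] --> (0 : R)^'+.
  have ln0 : - ln r @[r --> (1 : R)^'-] --> (0 : R).
    apply: cvg_at_left_filter; rewrite -oppr0 -ln1; apply: cvgN.
    exact: continuous_ln.
  (* The limit has to be reached from the right: r < 1 makes -ln r positive. *)
  move=> A A0; have lnA : \forall r \near 1^'-, 0 < - ln r -> A (- ln r).
    exact: ln0 A0.
  change (\forall r \near (1 : R)^'-, A (- ln r)).
  near=> r; have r1 : r < 1 by near: r; exact: nbhs_left_lt.
  have r0 : 0 < r by near: r; exact: nbhs_left_gt.
  apply: (near lnA r) => //.
  by rewrite oppr_gt0 ln_lt0// r0.
have := cvg_comp _ _ lnl Ql; apply: cvg_trans; apply: near_eq_cvg.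
near=> r; rewrite /= opprK lnK// posrE.
by near: r; exact: nbhs_left_gt.
Unshelve. all: by end_near. Qed.

(** * The equivalent and the three ranges of gamma *)

Theorem proposition5p8 (R : realType) (N : nat) (c gamma : R)
    (N_gt0 : (0 < N)%N) (c_gt0 : 0 < c)
    (gamma_gt0 : 0 < gamma) (gamma_lt1 : gamma < 1) :
  equiv_at_right0
    (fun u : R => Q (tseq N c gamma) N (expR (- u)))
    (fun u : R => c ^+ 2 * Gamma (2 * gamma + 1) /
                  (2 * N%:R) `^ (2 * gamma + 1) * u `^ (1 - 2 * gamma))
  /\ (gamma < 1 / 2 -> qstar (tseq N c gamma) N = 0%:E)
  /\ (gamma = 1 / 2 -> qstar (tseq N c gamma) N = (c ^+ 2 / (4 * N%:R ^+ 2))%:E)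
  /\ (1 / 2 < gamma -> qstar (tseq N c gamma) N = +oo%E).
Proof.
have [q q1 QE] := cvg_Q_ratio N c gamma N_gt0 c_gt0 gamma_gt0 gamma_lt1.
have g_gt0 (u : R) : 0 < u -> 0 < Qequiv N c gamma u.
  by move=> u0; exact: Qequiv_gt0.
have Q_cvg l : (q u * Qequiv N c gamma u)%:E @[u --> 0^'+] --> l ->
    qstar (tseq N c gamma) N = l.
  move=> ql; apply: qstar_cvg; apply: cvg_trans ql; apply: near_eq_cvg.
  by near=> u; rewrite QE.
have Q_cvg_fin (l : R) : Qequiv N c gamma u @[u --> 0^'+] --> l ->
    qstar (tseq N c gamma) N = l%:E.
  move=> gl; apply: Q_cvg; apply: cvg_EFin; first exact: nearW.
  by rewrite -[l]mul1r; exact: cvgM.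
have N0 : 0 < N%:R :> R by rewrite ltr0n.
split; last split; last split.
- rewrite /equiv_at_right0; apply: (@cvg_trans _ ((q u)%:E @[u --> 0^'+])).
    apply: near_eq_cvg; near=> u.
    have u0 : 0 < u by near: u; exact: nbhs_right_gt.
    (* Inversion in [\bar R] treats 0 separately; positivity of [Qequiv] reduces it to real
       inversion. *)
    have g0 := g_gt0 u u0; rewrite QE// -/(Qequiv _ _ _ u) inver gt_eqF//.
    by rewrite -EFinM mulfK// gt_eqF.
  by apply: cvg_EFin; first exact: nearW.
- move=> g2; apply: Q_cvg_fin.
  rewrite -[X in _ --> X](mulr0 (c ^+ 2 * Gamma (2 * gamma + 1) /
    (2 * N%:R) `^ (2 * gamma + 1))).
  by apply: cvgMl_tmp; apply: powR_cvg0; lra.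
- move=> g2; apply: Q_cvg_fin.
  (* The exponent of u is 0 and u^0 = 1 for every real u, so [Qequiv] is constantly c^2 Gamma(2) /
     (2N)^2. *)
  have -> : Qequiv N c gamma = fun=> c ^+ 2 / (4 * N%:R ^+ 2).
    apply/funext => u; rewrite /Qequiv.
    have -> : 1 - 2 * gamma = 0 by lra.
    have -> : 2 * gamma + 1 = 2%:R by lra.
    rewrite powRr0 Gamma2 powR_mulrn ?mulr_ge0//.
    by field; rewrite gt_eqF.
  exact: cvg_cst.
- move=> g2; apply: Q_cvg.
  (* For a positive function it suffices that the inverse tends to 0; here the inverse carries the
     positive power u^{2 gamma - 1}. *)
  apply/cvgeryP; apply/gtr0_cvgV0.
    near=> u; have u0 : 0 < u by near: u; exact: nbhs_right_gt.
    rewrite mulr_gt0 ?g_gt0//; near: u.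
    exact: (cvgr_gt _ q1 _ ltr01).
  set C := c ^+ 2 * Gamma (2 * gamma + 1) / (2 * N%:R) `^ (2 * gamma + 1).
  have Vq : (q u)^-1 * (C^-1 * u `^ (2 * gamma - 1)) @[u --> 0^'+] --> (0 : R).
    rewrite -[X in _ --> X](mulr0 1^-1); apply: cvgM; first exact: cvgV.
    rewrite -[X in _ --> X](mulr0 C^-1); apply: cvgMl_tmp.
    by apply: powR_cvg0; lra.
  apply: cvg_trans Vq; apply: near_eq_cvg; near=> u.
  rewrite /Qequiv -/C /= -(opprB _ 1) powRN.
  by rewrite [RHS]invfM [X in _ = _ * X]invfM invrK.
Unshelve. all: by end_near. Qed.
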